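(* Let $A\in\ell$ be a $\sigma$-compact group such that $A^{(1)}=0$, and let $C\in\ell$ be a divisible group. Then every extension of $A$ by $C$ in $\ell$ that is both a $TFU$ extension and a pure extension splits.
   Context: All groups are Hausdorff topological abelian groups, written additively. $\ell$ is the category of locally compact abelian (LCA) groups with continuous homomorphisms as morphisms. A morphism is proper if it is open onto its image. An extension of $A$ by $C$ in $\ell$ is a short exact sequence $0\to A\stackrel{\phi}{\to}B\stackrel{\psi}{\to}C\to 0$ in $\ell$ in which $\phi$ and $\psi$ are proper morphisms. A subgroup $H$ of $G$ is pure if $H\cap nG=nH$ for every positive integer $n$; the extension is pure if $\phi(A)$ is pure in $B$. For a group $G$, $G^{(1)}=\bigcap_{n\ge 1}nG$ is the first Ulm subgroup, and $\overline{S}$ denotes the closure of $S$. $G$ is divisible if $nG=G$ for every positive integer $n$. An extension $0\to A\stackrel{\phi}{\to}B\stackrel{\psi}{\to}C\to 0$ in $\ell$ is a $TFU$ extension if $0\to\overline{A^{(1)}}\stackrel{\overline{\phi}}{\to}\overline{B^{(1)}}\stackrel{\overline{\psi}}{\to}\overline{C^{(1)}}\to 0$ is an extension, where $\overline{\phi}=\phi|_{\overline{A^{(1)}}}$ and $\overline{\psi}=\psi|_{\overline{B^{(1)}}}$. Two extensions $0\to A\stackrel{\phi_1}{\to}B\stackrel{\psi_1}{\to}C\to 0$ and $0\to A\stackrel{\phi_2}{\to}X\stackrel{\psi_2}{\to}C\to 0$ are equivalent if there is a topological isomorphism $\beta:B\to X$ with $\beta\phi_1=\phi_2$ and $\psi_2\beta=\psi_1$.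 An extension splits if it is equivalent to the trivial extension $0\to A\to A\oplus C\to C\to 0$. *)

(* Defs.v *)
From HB Require Import structures.
From mathcomp Require Import all_boot all_algebra all_classical.
From mathcomp Require Import topology tvs.

Set Implicit Arguments.
Unset Strict Implicit.
Unset Printing Implicit Defensive.

Import GRing.Theory.
Local Open Scope classical_set_scope.
Local Open Scope ring_scope.

HB.mixin Record isLCA G & TopologicalZmodule G := {
  lca_hausdorff : hausdorff_space G ;
  lca_locally_compact : locally_compact [set: G] }.

#[short(type="lcaType")]
HB.structure Definition LCA := {G of TopologicalZmodule G & isLCA G}.

#[short(type="lcaHom")]
HB.structure Definition LCAHom (G H : lcaType) :=
  {f of @Continuous G H f & @GRing.Additive G H f}.

(** Open onto its image: a subset of [range f] is open for the topology of
    [subspace (range f)], whose carrier is all of [H], if and only if it is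
    relatively open in [range f]. *)
Definition proper_hom (G H : lcaType) (f : lcaHom G H) : Prop :=
  forall U : set G, open U -> open (f @` U : set (subspace (range f))).

Definition is_extension (A B C : lcaType) (phi : lcaHom A B)
    (psi : lcaHom B C) : Prop :=
  [/\ injective phi, range phi = psi @^-1` [set 0],
      range psi = [set: C], proper_hom phi & proper_hom psi].

Fact locally_compactTE (T : topologicalType) :
  locally_compact [set: T] <->
  forall x : T, exists2 K, nbhs x K & compact K /\ closed K.
Proof.
split=> [lcT x | lcT x _].
  have [K + cK] := lcT x I; rewrite /within/= => nK; exists K => //.
  by apply: filterS nK => y; exact.
have [K nK cK] := lcT x; exists K => //.
by rewrite /within/=; apply: filterS nK.
Qed.

Definition sigma_compact (T : topologicalType) : Prop :=
  exists2 K : nat -> set T, forall i, compact (K i) & \bigcup_i K i = [set: T].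

Definition mulset (G : zmodType) (n : nat) (S : set G) : set G :=
  [set x *+ n | x in S].

Definition pure (G : zmodType) (H : set G) : Prop :=
  forall n : nat, (0 < n)%N -> H `&` mulset n [set: G] = mulset n H.

Definition divisible (G : zmodType) : Prop :=
  forall n : nat, (0 < n)%N -> mulset n [set: G] = [set: G].

Definition ulm (G : zmodType) : set G :=
  \bigcap_(n in [set n : nat | (0 < n)%N]) mulset n [set: G].
Arguments ulm : clear implicits.

Definition is_pure_extension (A B C : lcaType) (phi : lcaHom A B)
    (psi : lcaHom B C) : Prop :=
  is_extension phi psi /\ pure (range phi).

Section UlmZmod.
Variable G : zmodType.

Lemma ulm_zmod_closed : ulm G 0 /\ forall x y, ulm G x -> ulm G y -> ulm G (x - y).
Proof.
split=> [n _|x y Ux Uy n n0]; first by exists 0; rewrite ?mul0rn.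
have [u _ <-] := Ux n n0; have [v _ <-] := Uy n n0.
by exists (u - v); rewrite ?mulrnBl.
Qed.

End UlmZmod.

Definition in_ulm_closure (G : lcaType) : {pred G} :=
  fun x => x \in closure (ulm G).

Section UlmClosedPred.
Variable G : lcaType.

Fact in_ulm_closure_zmod_closed : zmod_closed (@in_ulm_closure G).
Proof.
have [U0 UB] := ulm_zmod_closed G; split.
  by rewrite unfold_in inE; exact: subset_closure.
move=> x y; rewrite !unfold_in !inE => cx cy W Wxy.
have [[/= P Q] [nP nQ] PQW] := @sub_continuous G (x, y) W Wxy.
have [u [Uu Pu]] := cx _ nP; have [v [Uv Qv]] := cy _ nQ.
by exists (u - v); split; [exact: UB | exact: (PQW (u, v))].
Qed.

HB.instance Definition _ :=
  GRing.isZmodClosed.Build G (@in_ulm_closure G) in_ulm_closure_zmod_closed.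

End UlmClosedPred.

Definition ulm_closure (G : lcaType) : Type := {x : G | in_ulm_closure x}.

Section UlmClosure.
Variable G : lcaType.

HB.instance Definition _ := SubChoice.on (ulm_closure G).
HB.instance Definition _ := [SubChoice_isSubZmodule of ulm_closure G by <:].
HB.instance Definition _ :=
  Topological.copy (ulm_closure G)
    (initial_topology (val : ulm_closure G -> G)).

Fact ulm_closure_val_continuous : continuous (val : ulm_closure G -> G).
Proof. exact: initial_continuous. Qed.

Fact nbhs_ulm_closure (x : ulm_closure G) (V : set (ulm_closure G)) :
  nbhs x V -> exists2 W, nbhs (val x) W & val @^-1` W `<=` V.
Proof.
case=> _ /= [] [W oW <-] Wx WV; exists W => //.
by apply: open_nbhs_nbhs; split.
Qed.

Fact ulm_closure_sub_continuous :
  continuous (fun x : ulm_closure G * ulm_closure G => x.1 - x.2).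
Proof.
move=> [x y] V /nbhs_ulm_closure[W nW WV].
have [[/= P Q] [nP nQ] PQW] := @sub_continuous G (val x, val y) W nW.
exists (val @^-1` P, val @^-1` Q).
  by split; exact: ulm_closure_val_continuous.
by move=> [u v] /= [Pu Qv]; apply/WV/(PQW (val u, val v)).
Qed.

HB.instance Definition _ :=
  PreTopologicalNmodule_isTopologicalZmodule.Build (ulm_closure G)
    ulm_closure_sub_continuous.

Fact ulm_closure_hausdorff : hausdorff_space (ulm_closure G).
Proof.
move=> x y xy; apply: val_inj; apply: (@lca_hausdorff G) => P Q nP nQ.
have [z [Pz Qz]] := xy _ _ (ulm_closure_val_continuous nP) (ulm_closure_val_continuous nQ).
by exists (val z).
Qed.

Fact ulm_closure_locally_compact : locally_compact [set: ulm_closure G].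
Proof.
apply/locally_compactTE => x.
have [K nK [cK clK]] :=
  (locally_compactTE G).1 (@lca_locally_compact G) (val x).
exists (val @^-1` K); first exact: ulm_closure_val_continuous.
split; last by apply: preimage_closed clK => y _; exact: ulm_closure_val_continuous.
move=> F PF FK; have [p [Kp Fp]] := cK (val @ F) _ FK.
have pU : in_ulm_closure p.
  rewrite /in_ulm_closure inE.
  rewrite ((closure_id (closure (ulm G))).1 (@closed_closure _ _)).
  have FU : F (val @^-1` closure (ulm G)).
    by apply: filterE => y /=; have := valP y; rewrite /in_ulm_closure inE.
  by move=> W nW; have [z zW] := Fp _ _ FU nW; exists z.
exists (Sub p pU); split=> // P V FP /nbhs_ulm_closure[W nW WV].
have FvP : F (val @^-1` (val @` P)) by apply: filterS FP; exact: preimage_image.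
have [_ [[z Pz <-] Wz]] := Fp _ _ FvP nW.
by exists z; split=> //; exact: WV.
Qed.

HB.instance Definition _ := isLCA.Build (ulm_closure G)
  ulm_closure_hausdorff ulm_closure_locally_compact.

End UlmClosure.

Lemma ulm_closure_hom (G H : lcaType) (f : lcaHom G H) (x : G) :
  in_ulm_closure x -> in_ulm_closure (f x).
Proof.
rewrite /in_ulm_closure !inE => cx W nW.
have [y [Uy Wy]] := cx _ (@cts_fun _ _ f x W nW); exists (f y); split=> // n n0.
by have [u _ <-] := Uy n n0; exists (f u); rewrite ?raddfMn.
Qed.

Section UlmRestriction.
Variables (G H : lcaType) (f : lcaHom G H).

Definition ulm_restr (x : ulm_closure G) : ulm_closure H :=
  exist _ (f (val x)) (ulm_closure_hom f (valP x)).

Fact ulm_restr_continuous : continuous ulm_restr.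
Proof.
move=> x V /nbhs_ulm_closure[W nW WV].
have fval : nbhs x ((f \o val) @^-1` W).
  exact: ulm_closure_val_continuous (@cts_fun _ _ f (val x) W nW).
suff : nbhs x (ulm_restr @^-1` V) by [].
by apply: filterS fval => y Wy; exact: WV.
Qed.

Fact ulm_restr_additive : zmod_morphism ulm_restr.
Proof. by move=> x y; apply: val_inj; rewrite /= !raddfB. Qed.

HB.instance Definition _ :=
  isContinuous.Build (ulm_closure G) (ulm_closure H) ulm_restr
    ulm_restr_continuous.
HB.instance Definition _ :=
  GRing.isZmodMorphism.Build (ulm_closure G) (ulm_closure H) ulm_restr
    ulm_restr_additive.

End UlmRestriction.

Definition is_TFU_extension (A B C : lcaType) (phi : lcaHom A B)
    (psi : lcaHom B C) : Prop :=
  is_extension phi psi /\ is_extension (ulm_restr phi) (ulm_restr psi).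

(** An alias, because the structures of topological abelian group already
    declared on the product type are those of products of [tvsType]s. *)
Definition dsum (A C : lcaType) : Type := (A * C)%type.

Section DirectSum.
Variables A C : lcaType.

HB.instance Definition _ := Topological.copy (dsum A C) (A * C)%type.
HB.instance Definition _ := GRing.Zmodule.copy (dsum A C) (A * C)%type.

Fact dsum_sub_continuous :
  continuous (fun x : dsum A C * dsum A C => x.1 - x.2).
Proof.
move=> [[a c] [a' c']] W [[/= P Q] [/= nP nQ] PQW].
have [[/= P1 P2] [nP1 nP2] PP] := @sub_continuous A (a, a') _ nP.
have [[/= Q1 Q2] [nQ1 nQ2] QQ] := @sub_continuous C (c, c') _ nQ.
exists (P1 `*` Q1, P2 `*` Q2).
  by split; [exists (P1, Q1) | exists (P2, Q2)].
move=> [[u v] [u' v']] /= [[? ?] [? ?]].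
by apply: PQW; split; [exact: (PP (u, u')) | exact: (QQ (v, v'))].
Qed.

HB.instance Definition _ :=
  PreTopologicalNmodule_isTopologicalZmodule.Build (dsum A C)
    dsum_sub_continuous.

Fact dsum_hausdorff : hausdorff_space (dsum A C).
Proof.
move=> [a c] [a' c'] acl; congr pair; apply: lca_hausdorff => P Q nP nQ.
- have [[u v] /= [Pu Qu]] := acl (fst @^-1` P) (fst @^-1` Q)
    (@cvg_fst _ _ _ _ _ _ nP) (@cvg_fst _ _ _ _ _ _ nQ).
  by exists u.
- have [[u v] /= [Pv Qv]] := acl (snd @^-1` P) (snd @^-1` Q)
    (@cvg_snd _ _ _ _ _ _ nP) (@cvg_snd _ _ _ _ _ _ nQ).
  by exists v.
Qed.

Fact dsum_locally_compact : locally_compact [set: dsum A C].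
Proof.
apply/locally_compactTE => -[a c].
have [K nK [cK clK]] := (locally_compactTE A).1 (@lca_locally_compact A) a.
have [L nL [cL clL]] := (locally_compactTE C).1 (@lca_locally_compact C) c.
exists (K `*` L); first by exists (K, L).
split; first exact: compact_setX.
rewrite -[_ `*` _]/(fst @^-1` K `&` snd @^-1` L).
apply: closedI; apply: preimage_closed => // x _.
  exact: cvg_fst.
exact: cvg_snd.
Qed.

HB.instance Definition _ := isLCA.Build (dsum A C)
  dsum_hausdorff dsum_locally_compact.

Definition dsum_inl (a : A) : dsum A C := (a, 0).
Definition dsum_snd (x : dsum A C) : C := x.2.

Fact dsum_inl_continuous : continuous dsum_inl.
Proof. by move=> a; apply: cvg_pair; [exact: cvg_id | exact: cvg_cst]. Qed.

Fact dsum_inl_additive : zmod_morphism dsum_inl.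
Proof. by move=> a b; rewrite /dsum_inl; congr pair; rewrite subr0. Qed.

Fact dsum_snd_continuous : continuous dsum_snd.
Proof. by move=> x; exact: cvg_snd. Qed.

Fact dsum_snd_additive : zmod_morphism dsum_snd.
Proof. by []. Qed.

HB.instance Definition _ :=
  isContinuous.Build A (dsum A C) dsum_inl dsum_inl_continuous.
HB.instance Definition _ :=
  GRing.isZmodMorphism.Build A (dsum A C) dsum_inl dsum_inl_additive.
HB.instance Definition _ :=
  isContinuous.Build (dsum A C) C dsum_snd dsum_snd_continuous.
HB.instance Definition _ :=
  GRing.isZmodMorphism.Build (dsum A C) C dsum_snd dsum_snd_additive.

End DirectSum.

Fact dsum_is_extension (A C : lcaType) :
  is_extension (@dsum_inl A C) (@dsum_snd A C).
Proof.
split=> [a b [] // | | | U oU | U oU].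
- apply/seteqP; split=> [x [a _ <-] // | [a c] c0].
  by exists a => //; congr pair.
- by apply/seteqP; split=> // c _; exists ((0, c) : dsum A C).
- apply/open_subspaceP; exists (fst @^-1` U).
    by apply: open_comp oU => x _; exact: cvg_fst.
  apply/seteqP; split=> [x [/= Ux [a _ ax]] | x [[a Ua <-] _]].
    by split; exists a => //; move: Ux; rewrite -ax.
  by split=> //; exists a.
- exact/open_subspaceW/(@snd_open A C).
Qed.

(** A topological isomorphism is a morphism [beta] with an inverse [gamma] that
    is again a morphism. *)
Definition extension_equiv (A C B X : lcaType)
    (phi1 : lcaHom A B) (psi1 : lcaHom B C)
    (phi2 : lcaHom A X) (psi2 : lcaHom X C) : Prop :=
  exists (beta : lcaHom B X) (gamma : lcaHom X B),
    [/\ cancel beta gamma, cancel gamma beta,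
        beta \o phi1 =1 phi2 & psi2 \o beta =1 psi1].

Definition splits (A B C : lcaType) (phi : lcaHom A B) (psi : lcaHom B C) :
    Prop :=
  extension_equiv phi psi (@dsum_inl A C) (@dsum_snd A C).

(* Main.v *)
(** Since [A^(1) = 0] and [C] is divisible, the Ulm sequence of a TFU extension
    reads [0 -> 0 -> cl B^(1) -> C -> 0]; so [psi] restricts to a topological
    isomorphism of [cl B^(1)] onto [C], whose inverse is a continuous
    homomorphic section of [psi], and a section splits the extension. *)

Require Import Defs.
From HB Require Import structures.
From mathcomp Require Import all_boot all_algebra all_classical.
From mathcomp Require Import topology tvs.

Set Implicit Arguments.
Unset Strict Implicit.
Unset Printing Implicit Defensive.

Import GRing.Theory.
Local Open Scope classical_set_scope.
Local Open Scope ring_scope.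

(** Bundles functions constructed inside a proof into morphisms. *)
Lemma lcaHom_of_continuous (G H : lcaType) (f : G -> H) :
  continuous f -> zmod_morphism f -> exists g : lcaHom G H, g =1 f.
Proof.
move=> cf af.
pose fC := isContinuous.Build G H f cf.
pose fA := GRing.isZmodMorphism.Build G H f af.
pose g : lcaHom G H := HB.pack f fC fA.
by exists g.
Qed.

Section HomTheory.
Variables (G H : lcaType) (f : lcaHom G H).

(* Instances of [raddfB] and [raddfN] in which [f] is coerced directly from
   [lcaHom], so that they chain with hypotheses on [f]. *)
Lemma lcaHomB x y : f (x - y) = f x - f y. Proof. exact: raddfB. Qed.
Lemma lcaHomN x : f (- x) = - f x. Proof. exact: raddfN. Qed.

End HomTheory.

(** An injective proper morphism is a homeomorphism onto its image, so a merely set-theoretic lift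
    [g] of [h] through [f], such as one given by [choice], is automatically a morphism. *)
Lemma proper_hom_inverse (G H K : lcaType) (f : lcaHom G H)
    (h : K -> H) (g : K -> G) :
  injective f -> proper_hom f -> continuous h -> zmod_morphism h ->
  (forall x, f (g x) = h x) -> exists k : lcaHom K G, forall x, f (k x) = h x.
Proof.
move=> finj fP ch ah fgh.
have cg : continuous g.
  apply/continuousP => U oU.
  have /open_subspaceP[W oW WU] := fP U oU.
  (* [W] is open in [H] and has the same trace on [range f] as the image of [U]. Since [h x] is
     [f (g x)] and [f] is injective, [g x] lies in [U] exactly when [h x] lies in [W]. *)
  suff -> : g @^-1` U = h @^-1` W by move/continuousP: ch; apply.
  have eqWU x : W (h x) <-> (f @` U) (h x).
    have rx : range f (h x) by exists (g x).
    have E : (W `&` range f) (h x) = (f @` U `&` range f) (h x) by rewrite WU.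
    split=> [Wx|Ux].
      by have [] : (f @` U `&` range f) (h x) by rewrite -E.
    by have [] : (W `&` range f) (h x) by rewrite E.
  apply/seteqP; split=> x /=.
    by move=> Ux; apply/eqWU; exists (g x).
  by move/eqWU => [u Uu]; rewrite -fgh => /finj <-.
have ag : zmod_morphism g.
  by move=> x y; apply: finj; rewrite fgh ah -!fgh lcaHomB.
have [k kg] := lcaHom_of_continuous cg ag.
by exists k => x; rewrite kg.
Qed.

Lemma continuous_sub (T : topologicalType) (G : lcaType) (f g : T -> G) :
  continuous f -> continuous g -> continuous (fun x => f x - g x).
Proof.
move=> cf cg x.
apply: (@continuous2_cvg _ _ _ _ _ _ f g (fun u v : G => u - v)) => //.
- exact: (@sub_continuous G (f x, g x)).
- exact: cf.
- exact: cg.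
Qed.

(** Each [b - s (psi b)] lies in the kernel of [psi], which is [range phi]; lifting through [phi]
    yields a retraction [r] of [phi], and [r] paired with [psi] is the isomorphism onto the direct
    sum. *)
Lemma splits_of_section (A B C : lcaType) (phi : lcaHom A B)
    (psi : lcaHom B C) (s : lcaHom C B) :
  is_extension phi psi -> cancel s psi -> splits phi psi.
Proof.
move=> [phi_inj phi_ker _ phi_proper _] sK.
have psi_phi a : psi (phi a) = 0.
  have : range phi (phi a) by exists a.
  by rewrite phi_ker.
have resE b : exists a, phi a = b - s (psi b).
  have : (psi @^-1` [set 0]) (b - s (psi b)) by rewrite /= lcaHomB sK subrr.
  by rewrite -phi_ker => -[a _ <-]; exists a.
have [g gE] := choice resE.
have cres : continuous (fun b => b - s (psi b)).
  apply: continuous_sub; first by move=> b; exact: cvg_id.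
  move=> b; apply: continuous_comp; exact: cts_fun.
have ares : zmod_morphism (fun b => b - s (psi b)).
  by move=> x y; rewrite !lcaHomB !opprD !opprK addrACA.
have [r rE] := proper_hom_inverse phi_inj phi_proper cres ares gE.
have cb : continuous (fun b => (r b, psi b) : dsum A C).
  by move=> b; apply: cvg_pair; exact: cts_fun.
have ab : zmod_morphism (fun b => (r b, psi b) : dsum A C).
  by move=> x y; rewrite !lcaHomB.
have [beta betaE] := lcaHom_of_continuous cb ab.
(* The inverse is [phi a + s c], written as a difference so that [continuous_sub] applies. *)
have cc : continuous (fun x : dsum A C => phi x.1 - s (- x.2)).
  apply: continuous_sub => x.
    by apply: continuous_comp; [exact: cvg_fst | exact: cts_fun].
  apply: (continuous_comp (f := fun x : dsum A C => - x.2) (g := s)).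
    by apply: continuous_comp; [exact: cvg_snd | exact: opp_continuous].
  exact: cts_fun.
have ac : zmod_morphism (fun x : dsum A C => phi x.1 - s (- x.2)).
  by move=> x y; rewrite !lcaHomN !opprK !lcaHomB opprD addrACA.
have [gamma gammaE] := lcaHom_of_continuous cc ac.
have r_phi a : r (phi a) = a.
  by apply: phi_inj; rewrite rE psi_phi raddf0 subr0.
have r_s c : r (s c) = 0.
  by apply: phi_inj; rewrite rE sK subrr raddf0.
exists beta, gamma; split.
- by move=> b; rewrite gammaE betaE /= rE lcaHomN opprK subrK.
- move=> [a c]; rewrite betaE gammaE /=.
  by rewrite !lcaHomB r_phi r_s psi_phi sK subr0 sub0r opprK.
- by move=> a; rewrite /= betaE r_phi psi_phi.
- by move=> b; rewrite /= betaE.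
Qed.

Lemma ulm_divisible (G : zmodType) : divisible G -> ulm G = [set: G].
Proof.
by move=> dG; apply/seteqP; split=> // x _ n n0; rewrite dG.
Qed.

Theorem lemma3p3 (A C : lcaType)
    (hA : sigma_compact A) (hA1 : ulm A = [set 0]) (hC : divisible C)
    (B : lcaType) (phi : lcaHom A B) (psi : lcaHom B C)
    (hext : is_extension phi psi)
    (hTFU : is_TFU_extension phi psi)
    (hpure : is_pure_extension phi psi) :
  splits phi psi.
Proof.
have [_ [_ uker usurj _ uproper]] := hTFU.
(* Points are closed in the Hausdorff group [A], so taking the closure adds nothing to [ulm A]. *)
have clA x : closure (ulm A) x -> x = 0.
  rewrite hA1 -((closure_id [set (0 : A)]).1 _) //.
  exact/accessible_closed_set1/hausdorff_accessible/lca_hausdorff.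
have psi_inj : injective (ulm_restr psi).
  apply: raddf_inj => x x0.
  have : (ulm_restr psi @^-1` [set 0]) x by [].
  rewrite -uker => -[a _ <-].
  suff -> : a = 0 by rewrite raddf0.
  apply/val_inj/clA.
  by have := valP a; rewrite /in_ulm_closure inE.
(* Divisibility makes the Ulm subgroup of [C] everything, so [j] inverts the inclusion of its
   closure. *)
have inC c : in_ulm_closure (c : C).
  by rewrite /in_ulm_closure inE ulm_divisible // closureT.
pose j (c : C) : ulm_closure C := exist _ c (inC c).
have cj : continuous j.
  by move=> c V /nbhs_ulm_closure[W nW WV]; apply: filterS nW => d Wd; exact: WV.
have aj : zmod_morphism j by move=> c d; exact: val_inj.
have lift c : exists b, ulm_restr psi b = j c.
  have : range (ulm_restr psi) (j c) by rewrite usurj.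
  by case=> b _ <-; exists b.
have [g gE] := choice lift.
(* Followed by the inclusion into [B], the lift [t] of [j] becomes the section. *)
have [t tE] := proper_hom_inverse psi_inj uproper cj aj gE.
have cs : continuous (fun c => val (t c)).
  move=> c; apply: continuous_comp; first exact: cts_fun.
  exact: ulm_closure_val_continuous.
have as_ : zmod_morphism (fun c => val (t c)) by move=> c d; rewrite !lcaHomB.
have [s sE] := lcaHom_of_continuous cs as_.
apply: (@splits_of_section _ _ _ phi psi s) => // c.
by rewrite sE; have /(congr1 val) := tE c.
Qed.
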